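(* For any infinite cardinal $\lambda$ there exists no topology $\tau$ on $\mathscr{I}_\lambda^{\infty}$ such that $(\mathscr{I}_\lambda^{\infty},\tau)$ is a compact semitopological semigroup.
   Context: All topological spaces are assumed Hausdorff. A semitopological semigroup is a semigroup equipped with a Hausdorff topology for which all left translations $x\mapsto sx$ and all right translations $x\mapsto xs$ are continuous. For a cardinal $\lambda$, $\mathscr{I}_\lambda$ denotes the symmetric inverse semigroup on the set $\lambda$: all one-to-one functions with domain and range subsets of $\lambda$ (including the empty transformation $0$), under composition $ab(x)=a(b(x))$ wherever defined. The rank of a transformation is the cardinality of its domain, $\mathscr{I}_\lambda^n$ is the ideal of transformations of rank at most $n$, and $\mathscr{I}_\lambda^{\infty}:=\bigcup_n\mathscr{I}_\lambda^n$ (union over all integers $n\ge 0$) is the subsemigroup of all transformations of finite rank. *)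

(* Defs.v *)
From HB Require Import structures.
From mathcomp Require Import all_boot.
From mathcomp Require Import boolp classical_sets functions cardinality.
From mathcomp Require Import filter topology.

Set Implicit Arguments.
Unset Strict Implicit.
Unset Printing Implicit Defensive.

Import Algebra.

Local Open Scope classical_set_scope.
Local Open Scope card_scope.
Local Open Scope group_scope.

(* [tau : topology_on T] is a topologicalType structure on the carrier T, and
   [topologized tau] is T with that topology. The equality and choice operators
   that the structure also carries play no role. *)
Definition topology_on (T : Type) := Topological.axioms_ T.

Definition topologized (T : Type) (tau : topology_on T) : topologicalType :=
  @Topological.Pack T tau.

Definition semitopological_semigroup (S : semigroupType) (tau : topology_on S) :=
  let T := topologized tau in
  [/\ hausdorff_space T,
      forall s : S, continuous ((fun x : S => s * x) : T -> T) &
      forall s : S, continuous ((fun x : S => x * s) : T -> T)].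

Definition compact_semitopological_semigroup (S : semigroupType)
    (tau : topology_on S) :=
  semitopological_semigroup tau /\ compact [set: topologized tau].

(* A partial transformation of X is a function X -> option X, with None for
   "undefined". *)
Record sym_inv (X : Type) := SymInv {
  sym_inv_fun :> X -> option X ;
  sym_inv_inj : forall x y z : X,
    sym_inv_fun x = Some z -> sym_inv_fun y = Some z -> x = y }.

HB.instance Definition _ (X : Type) := gen_eqMixin (sym_inv X).
HB.instance Definition _ (X : Type) := gen_choiceMixin (sym_inv X).

Lemma sym_inv_ext (X : Type) (a b : sym_inv X) : a =1 b -> a = b.
Proof.
case: a b => [f fi] [g gi] /= /funext fg; case: _ / fg gi => gi.
by congr SymInv; exact: Prop_irrelevance.
Qed.

Section SymInvSemigroup.
Variable X : Type.
Implicit Types a b c : sym_inv X.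

Lemma sym_inv_mul_inj a b x y z :
  obind a (b x) = Some z -> obind a (b y) = Some z -> x = y.
Proof.
case bx: (b x) => [u|//] /= au; case bY: (b y) => [v|//] /= av.
by apply: (sym_inv_inj bx); rewrite (sym_inv_inj au av).
Qed.

Definition sym_inv_mul a b : sym_inv X :=
  @SymInv X (fun x => obind a (b x)) (@sym_inv_mul_inj a b).

Lemma sym_inv_mulA : associative sym_inv_mul.
Proof. by move=> a b c; apply: sym_inv_ext => x /=; case: (c x). Qed.

HB.instance Definition _ := isSemigroup.Build (sym_inv X) sym_inv_mulA.

Definition sym_inv_dom a : set X := [set x | isSome (a x)].

Definition rank_le (n : nat) : set (sym_inv X) :=
  [set a | sym_inv_dom a #<= `I_n].

Definition finite_rank : set (sym_inv X) := \bigcup_(n in [set: nat]) rank_le n.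

Definition finite_rank_pred : {pred sym_inv X} := fun a => `[< finite_rank a >].

Lemma finite_rank_mulg_closed : mulg_closed finite_rank_pred.
Proof.
move=> a b _ /asboolP[n _ bn]; apply/asboolP; exists n => //.
apply: card_le_trans bn; apply: subset_card_le => x.
by rewrite /sym_inv_dom /=; case: (b x).
Qed.

End SymInvSemigroup.

Record fin_sym_inv (X : Type) := FinSymInv {
  fin_sym_inv_val :> sym_inv X ;
  fin_sym_invP : finite_rank_pred fin_sym_inv_val }.

HB.instance Definition _ (X : Type) := [isSub for @fin_sym_inv_val X].
HB.instance Definition _ (X : Type) := [Choice of fin_sym_inv X by <:].
HB.instance Definition _ (X : Type) :=
  SubChoice_isSubSemigroup.Build (sym_inv X) (@finite_rank_pred X)
    (fin_sym_inv X) (@finite_rank_mulg_closed X).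

(* Main.v *)
Require Import Defs.
From mathcomp Require Import all_boot.
From mathcomp Require Import boolp classical_sets functions cardinality.
From mathcomp Require Import filter topology.

(** The identity maps [u n] of an increasing chain of [n]-point sets satisfy
    [u m * u n = u m] for [m <= n]. By compactness the sequence [u] has a
    cluster point [p], and continuity of left translations together with the
    Hausdorff property gives [u m * p = u m] for every [m]. Hence [p] is defined
    on infinitely many points, which is absurd for a map of finite rank. *)

Local Open Scope classical_set_scope.
Local Open Scope card_scope.

Lemma compact_semitopological_right_unit {S : semigroupType}
    {tau : topology_on S} (u : nat -> S) :
  compact_semitopological_semigroup (S := S) tau ->
  (forall m n, m <= n -> (u m * u n)%g = u m) ->
  exists p : S, forall m, (u m * p)%g = u m.
Proof.
move=> [[hT lT _] cT] uM.
have [p [_ pu]] := cT (nbhs ((u : nat -> topologized tau) @ \oo)) _ filterT.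
(* It suffices that each neighbourhood [A] of [u m * p] meets each neighbourhood [B] of [u m]; the
   common point is [u m] itself, equal to [u m * u n] for some late [u n] that left translation by
   [u m] sends into [A]. *)
exists p => m; apply: hT => A B nA nB.
have nA' := lT (u m) p _ nA.
have Fm : nbhs ((u : nat -> topologized tau) @ \oo) (u @` [set n | m <= n]).
  by exists m => // n mn; exists n.
have [_ [[n mn <-]]] := pu _ _ Fm nA'.
by rewrite /= uM // => Aum; exists (u m); split => //; exact: nbhs_singleton nB.
Qed.

Section PartialIdentity.
Set Implicit Arguments.
Variable X : Type.

(** Partial identities are the idempotents of [sym_inv X]. *)
Definition pid_fun (A : set X) (x : X) : option X :=
  if `[< A x >] then Some x else None.

Lemma pid_fun_inj A x y z :
  pid_fun A x = Some z -> pid_fun A y = Some z -> x = y.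
Proof.
by rewrite /pid_fun; case: ifP => // _ [->]; case: ifP => // _ [->].
Qed.

Definition pid (A : set X) : sym_inv X := SymInv (@pid_fun_inj A).

Lemma pid_mulg A B : (pid A * pid B)%g = pid (A `&` B).
Proof.
apply: sym_inv_ext => x; rewrite /= /pid_fun asbool_and andbC.
by case: `[< B x >].
Qed.

Lemma sym_inv_dom_pid A : sym_inv_dom (pid A) = A.
Proof.
by apply/seteqP; split => x; rewrite /sym_inv_dom /= /pid_fun; case: asboolP.
Qed.

(** The right factor acts first. Applied to [u m * p = u m], this puts the domain of [u m] inside
    that of [p]. *)
Lemma sym_inv_dom_mulg (a b : sym_inv X) :
  sym_inv_dom (a * b)%g `<=` sym_inv_dom b.
Proof. by move=> x; rewrite /sym_inv_dom /=; case: (b x). Qed.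

Lemma finite_rankP (a : sym_inv X) :
  finite_rank a <-> finite_set (sym_inv_dom a).
Proof.
split=> [[n _ /card_le_finite]|/finite_set_leP[n]]; last by exists n.
by apply; exact: finite_II.
Qed.

Lemma fin_pid_subproof (A : set X) :
  finite_set A -> finite_rank_pred (pid A).
Proof. by move=> fA; apply/asboolP/finite_rankP; rewrite sym_inv_dom_pid. Qed.

Definition fin_pid (A : set X) (fA : finite_set A) : fin_sym_inv X :=
  FinSymInv (fin_pid_subproof fA).

End PartialIdentity.

Theorem theorem24 (X : Type) (hX : infinite_set [set: X]) :
  ~ exists tau : topology_on (fin_sym_inv X),
      compact_semitopological_semigroup (S := fin_sym_inv X) tau.
Proof.
move=> [tau ctau].
have /card_leP/unsquash f0 := (infiniteP _).1 hX.
(* [f0] maps between the subtypes of the full sets; [to_setT] and [set_val] turn it into an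
   injection from [nat] to [X]. *)
pose f : {inj [set: nat] >-> X} := set_val \o f0 \o to_setT.
have fI n : finite_set (f @` `I_n) by exact/finite_image/finite_II.
have uM m n : m <= n -> (fin_pid (fI m) * fin_pid (fI n))%g = fin_pid (fI m).
  move=> mn; apply: val_inj; rewrite /= pid_mulg; congr pid.
  apply/setIidPl/image_subset => i /= im; exact: leq_trans im mn.
have [p pM] := compact_semitopological_right_unit _ ctau uM.
have /asboolP/finite_rankP := fin_sym_invP p.
have fdom : range f `<=` sym_inv_dom p.
  (* The index is [i.+1] because [I_n] contains only the numbers strictly below [n]. *)
  move=> _ [i _ <-]; have : sym_inv_dom (fin_pid (fI i.+1)) (f i).
    by rewrite sym_inv_dom_pid; exists i => /=.
  by rewrite -pM; apply: sym_inv_dom_mulg.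
move=> /(sub_finite_set fdom); rewrite (eq_finite_set (card_image f)).
exact: infinite_nat.
Qed.
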